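(* Let $(A,\mathfrak m)$ be a nonzero commutative local ring and let $R=\mathcal T(A)$. Suppose $A$ contains a regular nonunit $a$. Let $t=(a,0)\in R$ and $C=R/tR$. Then $$\mathrm{fd}_R C=1,\qquad \mathrm{pd}_R C=2.$$ The module $C$ is finitely presented, but its first syzygy $tR$ is not finitely presented.
   Context: All rings are commutative with identity and all modules are unital. For a nonzero local ring $(A,\mathfrak m)$ (not necessarily Noetherian) with residue field $\kappa=A/\mathfrak m$ and residue map $a\mapsto\bar a$, define the ring, with coordinatewise operations, $$\mathcal T(A)=\{(a,(c_i)_{i\in\mathbb N})\in A\times\kappa^{\mathbb N}: c_i=\bar a\text{ for all but finitely many }i\},\quad \mathbb N=\{1,2,\ldots\}.$$ $(a,0)$ denotes the element with first coordinate $a$ and zero sequence. An element is regular if it is a non-zero-divisor. $\mathrm{fd}$ and $\mathrm{pd}$ denote flat and projective dimension (least length of a flat, respectively projective, resolution). *)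

(* Defs.v *)
From HB Require Import structures.
From mathcomp Require Import all_boot all_algebra.
From mathcomp Require Import ring_quotient.
From mathcomp Require Import boolp classical_sets functions cardinality.
From mathcomp Require Import freeg.

Set Implicit Arguments.
Unset Strict Implicit.
Unset Printing Implicit Defensive.

Import GRing.Theory.

Local Open Scope classical_set_scope.
Local Open Scope ring_scope.
Local Open Scope quotient_scope.

(* An [idealr] is a proper ideal. *)
Definition maximal_ideal (A : comNzRingType) (I : idealr A) : Prop :=
  forall J : idealr A, {subset I <= J} -> J =i I.

Definition is_local (A : comNzRingType) (m : idealr A) : Prop :=
  maximal_ideal m /\ forall J : idealr A, maximal_ideal J -> J =i m.

(* [set0] is added to the family because [Zorn_bigcup] also asks for the union
   of the empty chain. *)
Lemma nonunit_maximal (A : comUnitRingType) (m : idealr A) (a : A) :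
  is_local m -> a \isn't a GRing.unit -> a \in m.
Proof.
move=> [_ m_uniq] a_nonunit.
pose chi (X : set A) : A -> bool := fun x => `[< X x >].
pose P (X : set A) := X = set0 \/ X a /\ idealr_closed (chi X).
have [|X [PX maxX]] := @Zorn_bigcup A P.
  move=> F FP Ftot.
  have [[Y0 FY0 Y0a]|noY] := pselect (exists2 Y, F Y & Y a); last first.
    left; apply/seteqP; split=> // x [Y FY Yx].
    case: (FP _ FY) => [Y0|[Ya _]]; first by rewrite Y0 in Yx.
    by case: noY; exists Y.
  have FPP Y x : F Y -> Y x -> idealr_closed (chi Y).
    by move=> FY Yx; case: (FP _ FY) => [Y0'|[_ //]]; rewrite Y0' in Yx.
  right; split; first by exists Y0.
  split.
  - by apply/asboolP; exists Y0 => //; have [/asboolP] := FPP _ _ FY0 Y0a.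
  - apply/negP => /asboolP[Y FY Y1].
    by have [_ /negP + _] := FPP _ _ FY Y1; apply; apply/asboolP.
  - move=> r u v /asboolP[U FU Uu] /asboolP[V FV Vv]; apply/asboolP.
    have [UV|VU] := Ftot _ _ FU FV.
      exists V => //; have [_ _ /(_ r u v)] := FPP _ _ FV Vv.
      by move=> /(_ (asboolT (UV _ Uu)) (asboolT Vv))/asboolP.
    exists U => //; have [_ _ /(_ r u v)] := FPP _ _ FU Uu.
    by move=> /(_ (asboolT Uu) (asboolT (VU _ Vv)))/asboolP.
have aAid : idealr_closed (chi [set x | exists r, x = r * a]).
  split.
  - by apply/asboolP; exists 0; rewrite mul0r.
  - apply/negP => /asboolP[r r1]; move/negP: a_nonunit; apply.
    by apply/unitrPr; exists r; rewrite mulrC.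
  - move=> r u v /asboolP[s ->] /asboolP[t ->]; apply/asboolP.
    by exists (r * s + t); rewrite mulrDl mulrA.
case: PX => [X0|[Xa Xid]].
  case: (maxX [set x | exists r, x = r * a]).
    rewrite X0; split=> // h; case: (h a); by exists 1; rewrite mul1r.
  by right; split=> //; exists 1; rewrite mul1r.
pose XI : idealr A := HB.pack_for (idealr A) (chi X)
  (isIdealr.Build A (chi X) Xid).
have XI_max : maximal_ideal XI.
  move=> J sXJ x; apply/idP/idP; last exact: sXJ.
  move=> Jx; apply/asboolP; apply: contrapT => nXx.
  apply: (maxX [set x | x \in J]).
    split=> [y Xy|/(_ x Jx)//]; apply: sXJ; exact/asboolP.
  right; split; first by apply: sXJ; apply/asboolP.
  have -> : chi [set x | x \in J] = (J : A -> bool).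
    by apply/funext => y; rewrite /chi /= asboolb.
  split; first exact: rpred0.
    by have := idealr1 J => /negbT.
  by move=> r u v Ju Jv; rewrite rpredD// idealMr.
by rewrite -(m_uniq _ XI_max); apply/asboolP.
Qed.

Section TRing.
Variables (A : comNzRingType) (m : idealr A).

Local Notation kappa := {ideal_quot m}.

(* The sequences are indexed from 0 instead of 1. *)
Definition eventually_residue : {pred A * (nat -> kappa)} :=
  fun x => `[< finite_set [set i | x.2 i <> \pi_kappa x.1] >].

Lemma eventually_residue_subring : subring_closed eventually_residue.
Proof.
split=> [|x y /asboolP xP /asboolP yP|x y /asboolP xP /asboolP yP]; apply/asboolP.
- apply: (@sub_finite_set _ _ set0) => // i /=; apply; exact/esym/rmorph1.
- apply: (@sub_finite_set _ _ ([set i | x.2 i <> \pi_kappa x.1] `|`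
                               [set i | y.2 i <> \pi_kappa y.1])).
    move=> i /=; apply: contra_notP => /not_orP[/contrapT xi /contrapT yi].
    by rewrite [in RHS]raddfB /= -xi -yi.
  by rewrite finite_setU.
- apply: (@sub_finite_set _ _ ([set i | x.2 i <> \pi_kappa x.1] `|`
                               [set i | y.2 i <> \pi_kappa y.1])).
    move=> i /=; apply: contra_notP => /not_orP[/contrapT xi /contrapT yi].
    by rewrite [in RHS]rmorphM /= -xi -yi.
  by rewrite finite_setU.
Qed.

HB.instance Definition _ :=
  GRing.isSubringClosed.Build (A * (nat -> kappa))%type eventually_residue
    eventually_residue_subring.

Record Tring : Type := MkTring {
  Tring_val :> A * (nat -> kappa);
  _ : Tring_val \in eventually_residue
}.

HB.instance Definition _ := [isSub for Tring_val].
HB.instance Definition _ := [Choice of Tring by <:].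
HB.instance Definition _ := [SubChoice_isSubComNzRing of Tring by <:].

Lemma eventually_residue0 (a : A) : a \in m -> (a, 0) \in eventually_residue.
Proof.
move=> am; apply/asboolP; apply: (@sub_finite_set _ _ set0) => // i /=; apply.
have /eqP -> : a == 0 %[mod kappa] by rewrite -Quotient.idealrBE subr0.
exact/esym/rmorph0.
Qed.

(* [(a, 0)] belongs to the ring only when [a] is in [m]. *)
Definition Tring0 (a : A) (am : a \in m) : Tring :=
  MkTring (eventually_residue0 am).

End TRing.

Section Submodule.
Variables (R : nzRingType) (M : lmodType R) (N : submodClosed M).

Record submod : Type := MkSubmod { submod_val :> M; _ : submod_val \in N }.

HB.instance Definition _ := [isSub for submod_val].
HB.instance Definition _ := [Choice of submod by <:].
HB.instance Definition _ := [SubChoice_isSubLmodule of submod by <:].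

(* [Quotient.quot] asks for a [zmodClosed] predicate, which [submodClosed] does
   not provide, although over a ring it could. *)
Definition additive_submod : {pred M} := N.

HB.instance Definition _ := GRing.isZmodClosed.Build M additive_submod
  (GRing.submod_closedB (submodClosedP N)).

Definition quotmod : Type := Quotient.quot additive_submod.

HB.instance Definition _ := GRing.Zmodule.on quotmod.

Definition quotmod_pi (x : M) : quotmod :=
  \pi_(Quotient.quot additive_submod) x.

Lemma quotmod_piP (x y : M) : quotmod_pi x = quotmod_pi y <-> x - y \in N.
Proof.
by rewrite -[_ \in N]/(_ \in additive_submod) Quotient.idealrBE; split=> /eqP.
Qed.

Lemma quotmod_pi_surj (z : quotmod) : exists x, quotmod_pi x = z.
Proof.
by exists (repr (z : Quotient.quot additive_submod)); rewrite /quotmod_pi reprK.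
Qed.

Lemma quotmod_piD (x y : M) :
  quotmod_pi (x + y) = quotmod_pi x + quotmod_pi y.
Proof. exact: raddfD. Qed.

Definition quotmod_scale (r : R) (z : quotmod) : quotmod :=
  quotmod_pi (r *: repr (z : Quotient.quot additive_submod)).

Lemma quotmod_scaleE (r : R) (x : M) :
  quotmod_scale r (quotmod_pi x) = quotmod_pi (r *: x).
Proof.
apply/quotmod_piP; rewrite -scalerBr rpredZ//.
by apply/quotmod_piP; rewrite /quotmod_pi reprK.
Qed.

Fact quotmod_scaleA a b v :
  quotmod_scale a (quotmod_scale b v) = quotmod_scale (a * b) v.
Proof. by have [x <-] := quotmod_pi_surj v; rewrite !quotmod_scaleE scalerA. Qed.

Fact quotmod_scale1 : left_id 1 quotmod_scale.
Proof.
by move=> v; have [x <-] := quotmod_pi_surj v; rewrite quotmod_scaleE scale1r.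
Qed.

Fact quotmod_scaleDr : right_distributive quotmod_scale +%R.
Proof.
move=> a u v; have [x <-] := quotmod_pi_surj u; have [y <-] := quotmod_pi_surj v.
by rewrite -quotmod_piD !quotmod_scaleE -quotmod_piD scalerDr.
Qed.

Fact quotmod_scaleDl v : {morph quotmod_scale^~ v : a b / a + b}.
Proof.
move=> a b; have [x <-] := quotmod_pi_surj v.
by rewrite !quotmod_scaleE -quotmod_piD scalerDl.
Qed.

HB.instance Definition _ := GRing.Zmodule_isLmodule.Build R quotmod
  quotmod_scaleA quotmod_scale1 quotmod_scaleDr quotmod_scaleDl.

Fact quotmod_pi_linear : linear quotmod_pi.
Proof. by move=> r x y; rewrite quotmod_piD -quotmod_scaleE. Qed.

HB.instance Definition _ := GRing.isLinear.Build R M quotmod _ quotmod_pi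
  quotmod_pi_linear.

End Submodule.

Section Span.
Variables (R : nzRingType) (M : lmodType R).

Definition cyclic_pred (v : M) : {pred M} :=
  fun x => `[< exists r : R, x = r *: v >].

Fact cyclic_pred_closed (v : M) : submod_closed (cyclic_pred v).
Proof.
split; first by apply/asboolP; exists 0; rewrite scale0r.
move=> r x y /asboolP[a ->] /asboolP[b ->]; apply/asboolP.
by exists (r * a + b); rewrite scalerDl scalerA.
Qed.

HB.instance Definition _ v := GRing.isSubmodClosed.Build R M (cyclic_pred v)
  (GRing.submod_closed_semi (cyclic_pred_closed v)).

Definition cyclic_submodule (v : M) : submodClosed M := cyclic_pred v.

Definition span_pred (S : set M) : {pred M} :=
  fun x => `[< forall N : submodClosed M,
              (forall y, S y -> y \in N) -> x \in N >].

Fact span_pred_closed (S : set M) : submod_closed (span_pred S).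
Proof.
split; first by apply/asboolP => N _; exact: rpred0.
move=> r x y /asboolP Sx /asboolP Sy; apply/asboolP => N SN.
by rewrite rpredD ?rpredZ ?Sx ?Sy.
Qed.

HB.instance Definition _ S := GRing.isSubmodClosed.Build R M (span_pred S)
  (GRing.submod_closed_semi (span_pred_closed S)).

Definition span_submodule (S : set M) : submodClosed M := span_pred S.

Lemma sub_span_submodule (S : set M) x : S x -> x \in span_submodule S.
Proof. by move=> Sx; apply/asboolP => N; apply. Qed.

End Span.

Section FreeLift.
Variables (R : nzRingType) (K : choiceType) (M : lmodType R) (f : K -> M).

HB.instance Definition _ := GRing.isZmodMorphism.Build {freeg K / R} M (fglift f)
  (lift_is_additive f).

Fact fglift_scalable : scalable (fglift f).
Proof.
move=> r D; have -> : r *: D = \sum_(x <- dom D) << r * coeff x D *g x >> by [].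
have -> : fglift f D = \sum_(x <- dom D) fglift f << coeff x D *g x >>.
  by rewrite -raddf_sum freeg_sumE.
rewrite raddf_sum scaler_sumr.
by apply: eq_bigr => x _; rewrite /= !liftU scalerA.
Qed.

HB.instance Definition _ := GRing.isScalable.Build R {freeg K / R} M _ (fglift f)
  fglift_scalable.

End FreeLift.

Section Tensor.
Variables (R : comNzRingType) (M N : lmodType R).

Local Notation F := {freeg (M * N)%type / R}.
Local Notation gen x y := (<< (x, y) >> : F).

Definition tensor_relation : set F := [set z |
  [\/ exists x x' y, z = gen (x + x') y - gen x y - gen x' y,
      exists x y y', z = gen x (y + y') - gen x y - gen x y',
      exists (r : R) x y, z = gen (r *: x) y - r *: gen x y
    | exists (r : R) x y, z = gen x (r *: y) - r *: gen x y]].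

Definition tensor : Type := quotmod (span_submodule tensor_relation).

HB.instance Definition _ := GRing.Lmodule.on tensor.

Definition tens (x : M) (y : N) : tensor :=
  quotmod_pi (span_submodule tensor_relation) (gen x y).

Lemma tensDl x x' y : tens (x + x') y = tens x y + tens x' y.
Proof.
rewrite /tens -[RHS]raddfD; apply/quotmod_piP/sub_span_submodule.
by rewrite opprD addrA; constructor 1; exists x, x', y.
Qed.

Lemma tensDr x y y' : tens x (y + y') = tens x y + tens x y'.
Proof.
rewrite /tens -[RHS]raddfD; apply/quotmod_piP/sub_span_submodule.
by rewrite opprD addrA; constructor 2; exists x, y, y'.
Qed.

Lemma tensZl r x y : tens (r *: x) y = r *: tens x y.
Proof.
rewrite /tens -[RHS]linearZ; apply/quotmod_piP/sub_span_submodule.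
by constructor 3; exists r, x, y.
Qed.

Lemma tensZr r x y : tens x (r *: y) = r *: tens x y.
Proof.
rewrite /tens -[RHS]linearZ; apply/quotmod_piP/sub_span_submodule.
by constructor 4; exists r, x, y.
Qed.

Lemma tensor_spanned (N' : submodClosed tensor) :
  (forall x y, tens x y \in N') -> forall z, z \in N'.
Proof.
move=> N'P z; have [D <-] := quotmod_pi_surj z.
rewrite -[D]freeg_sumE raddf_sum; apply: rpred_sum => -[x y] _.
have -> : << coeff (x, y) D *g (x, y) >> = coeff (x, y) D *: gen x y.
  by apply/eqP/freeg_eqP => p; rewrite coeffZ !coeffU mul1r.
move: (coeff _ _) => c.
have := rpredZ c (N'P x y); rewrite /tens -[c *: _]linearZ; exact.
Qed.

Section Lift.
Variables (P : lmodType R) (B : M -> N -> P).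

(* The linear map induced by a bilinear [B]; for other [B] the value
   depends on the representative [repr z]. *)
Definition tensor_lift (z : tensor) : P :=
  fglift (fun p : M * N => B p.1 p.2) (repr (z : Quotient.quot _)).

Hypothesis B_bilinear : bilinear_for *:%R *:%R B.

Lemma tensor_lift_pi (D : F) :
  tensor_lift (quotmod_pi (span_submodule tensor_relation) D) =
  fglift (fun p : M * N => B p.1 p.2) D.
Proof.
have [g gE] : exists g : {linear F -> P},
    forall D, fglift (fun p : M * N => B p.1 p.2) D = g D by eexists.
pose ker : {pred F} := fun D => g D == 0.
have ker_submod : submod_closed ker.
  split; first by apply/eqP; exact: raddf0.
  move=> r x y /eqP x0 /eqP y0; apply/eqP.
  by rewrite linearP x0 y0 scaler0 addr0.
pose K : submodClosed F := HB.pack_for (submodClosed F) ker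
  (GRing.isSubmodClosed.Build R F ker (GRing.submod_closed_semi ker_submod)).
have g1 x y : g (gen x y) = B x y by rewrite -gE liftU scale1r.
have gZ r z : g (r *: z) = r *: g z by exact: linearZ.
have sK z : tensor_relation z -> z \in K.
  have Bl y r x x' : B (r *: x + x') y = r *: B x y + B x' y.
    exact: B_bilinear.1.
  have Br x r y y' : B x (r *: y + y') = r *: B x y + B x y'.
    exact: B_bilinear.2.
  have Bl0 y : B 0 y = 0.
    by have /eqP := Bl y 1 0 0; rewrite !scale1r addr0 -subr_eq0 opprD addrA
      subrr sub0r oppr_eq0 => /eqP.
  have Br0 x : B x 0 = 0.
    by have /eqP := Br x 1 0 0; rewrite !scale1r addr0 -subr_eq0 opprD addrA
      subrr sub0r oppr_eq0 => /eqP.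
  case=> [[x [x' [y ->]]]|[x [y [y' ->]]]|[r [x [y ->]]]|[r [x [y ->]]]];
    apply/eqP; rewrite ?raddfB /= ?gZ !g1.
  - by have := Bl y 1 x x'; rewrite !scale1r => ->;
       rewrite [X in X - _ - _]addrC addrK subrr.
  - by have := Br x 1 y y'; rewrite !scale1r => ->;
       rewrite [X in X - _ - _]addrC addrK subrr.
  - by have := Bl y r x 0; rewrite Bl0 !addr0 => ->; rewrite subrr.
  - by have := Br x r y 0; rewrite Br0 !addr0 => ->; rewrite subrr.
apply/eqP; rewrite /tensor_lift !gE -subr_eq0 -raddfB; apply: (_ : _ \in K).
have : repr (quotmod_pi (span_submodule tensor_relation) D : Quotient.quot _) - D
         \in span_submodule tensor_relation.
  by apply/quotmod_piP; rewrite {1}/quotmod_pi reprK.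
by move/asboolP; apply.
Qed.

Lemma tensor_lift_linear : linear tensor_lift.
Proof.
move=> r u v; have [x <-] := quotmod_pi_surj u; have [y <-] := quotmod_pi_surj v.
by rewrite -[_ *: _ + _]linearP !tensor_lift_pi linearP.
Qed.

Lemma tensor_liftE x y : tensor_lift (tens x y) = B x y.
Proof. by rewrite tensor_lift_pi liftU scale1r. Qed.

End Lift.
End Tensor.

Section TensorMap.
Variables (R : comNzRingType) (N N' M : lmodType R) (f : {linear N -> N'}).

Definition tensor_map : tensor N M -> tensor N' M :=
  tensor_lift (fun x y => tens (f x) y).

Fact tensor_map_bilinear :
  bilinear_for *:%R *:%R (fun (x : N) (y : M) => tens (f x) y).
Proof.
by split=> [y|x] r u v; rewrite ?linearP (tensDl, tensDr) (tensZl, tensZr).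
Qed.

Fact tensor_map_linear : linear tensor_map.
Proof. exact: tensor_lift_linear tensor_map_bilinear. Qed.

HB.instance Definition _ := GRing.isLinear.Build R (tensor N M) (tensor N' M) _
  tensor_map tensor_map_linear.

Lemma tensor_mapE x y : tensor_map (tens x y) = tens (f x) y.
Proof. exact: tensor_liftE tensor_map_bilinear _ _. Qed.

End TensorMap.

Arguments tensor_map {R N N'} M f.

Section Homological.
Variable R : comNzRingType.
Implicit Types M N P : lmodType R.

Definition surjective (S T : Type) (f : S -> T) : Prop :=
  forall y, exists x, f x = y.

Definition exact_at M N P (f : {linear M -> N}) (g : {linear N -> P}) : Prop :=
  forall y, g y = 0 <-> exists x, f x = y.

Definition flat M : Prop :=
  forall N N' (f : {linear N -> N'}),
    injective f -> injective (tensor_map M f).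

Definition projective P : Prop :=
  forall M N (g : {linear M -> N}) (f : {linear P -> N}),
    surjective g -> exists h : {linear P -> M}, forall x, g (h x) = f x.

Definition finitely_presented M : Prop :=
  exists (p q : nat) (g : {linear 'rV[R]_p -> 'rV[R]_q})
      (f : {linear 'rV[R]_q -> M}),
    exact_at g f /\ surjective f.

Record resolution M : Type := Resolution {
  res_obj :> nat -> lmodType R;
  res_diff : forall i, {linear res_obj i.+1 -> res_obj i};
  res_aug : {linear res_obj 0 -> M};
  res_aug_surj : surjective res_aug;
  res_exact0 : exact_at (res_diff 0) res_aug;
  res_exactS : forall i, exact_at (res_diff i.+1) (res_diff i)
}.

(* A resolution [0 -> F n -> ... -> F 0 -> M -> 0] is extended by zero modules
   in degrees [> n]. *)
Definition has_resolution (Q : lmodType R -> Prop) M (n : nat) : Prop :=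
  exists F : resolution M,
    (forall i, Q (F i)) /\ forall i, (n < i)%N -> forall x : F i, x = 0.

Definition least_resolution_length (Q : lmodType R -> Prop) M (n : nat) : Prop :=
  has_resolution Q M n /\ forall k, has_resolution Q M k -> (n <= k)%N.

Definition fd_eq M (n : nat) : Prop := least_resolution_length flat M n.

Definition pd_eq M (n : nat) : Prop := least_resolution_length projective M n.

End Homological.

(* Main.v *)
Require Import Defs.
From HB Require Import structures.
From mathcomp Require Import all_boot all_algebra.
From mathcomp Require Import ring_quotient.
From mathcomp Require Import boolp classical_sets cardinality.
Local Open Scope ring_scope.

Set Implicit Arguments.
Unset Strict Implicit.
Unset Printing Implicit Defensive.

Import GRing.Theory.

(** Let [e_k] in R be the sequence with k ones followed by zeros and first
    coordinate 0. The annihilator J of t is the increasing union of the ideals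
    [e_k R], and the [e_k] are idempotents which never stabilize. Hence
    tR = R/J is flat (x in N becomes zero in N/JN iff [x = e_k x] for some k,
    and this descends along injections), J is the direct sum of the projective
    ideals [(e_{k+1} - e_k) R], and J lies in no [e_k R]. The exact sequences
    0 -> tR -> R -> C -> 0 and 0 -> J -> R -> tR -> 0 give the upper bounds.
    If C were flat, t would be in t^2 R, making a invertible. If tR were
    finitely presented, or if C had projective dimension at most 1, then J
    would be contained in some [e_k R]. *)

(** * Submodules from closed propositions; vanishing tensors *)

Section SubmodOf.
Variables (R : comNzRingType) (M : lmodType R) (P : M -> Prop).
Hypothesis P_closed : P 0 /\ forall r x y, P x -> P y -> P (r *: x + y).

Lemma submod_of_closed : submod_closed (fun x => `[< P x >] : bool).
Proof.
split; first by apply/asboolP; exact: P_closed.1.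
by move=> r x y /asboolP Px /asboolP Py; apply/asboolP; exact: P_closed.2.
Qed.

Definition submod_of : submodClosed M :=
  HB.pack_for (submodClosed M) (fun x : M => `[< P x >])
    (GRing.isSubmodClosed.Build R M (fun x => `[< P x >])
      (GRing.submod_closed_semi submod_of_closed)).

Lemma submod_ofP x : reflect (P x) (x \in submod_of).
Proof. exact: asboolP. Qed.

End SubmodOf.

Lemma tens0l (R : comNzRingType) (M N : lmodType R) (y : N) :
  tens 0 y = 0 :> tensor M N.
Proof. by have := tensZl 0 (0 : M) y; rewrite !scale0r. Qed.

Lemma tens0r (R : comNzRingType) (M N : lmodType R) (x : M) :
  tens x 0 = 0 :> tensor M N.
Proof. by have := tensZr 0 x (0 : N); rewrite !scale0r. Qed.

(** [tensor_lift B] is not bundled as a linear map, so its value at 0 is computed on [tens 0 0]. *)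
Lemma tensor_lift0 (R : comNzRingType) (M N P : lmodType R)
    (B : M -> N -> P) : bilinear_for *:%R *:%R B -> tensor_lift B 0 = 0.
Proof.
move=> Bb; rewrite -(tens0l M (0 : N)) (tensor_liftE Bb) /=.
have /= := Bb.1 0 (-1) 0 0.
by rewrite scaler0 addr0 scaleN1r addNr.
Qed.

(** * Flatness of cyclic modules *)

Section FlatCyclic.
Variables (R : comNzRingType) (M : lmodType R) (u : M).
Hypothesis u_gen : forall x : M, exists r, x = r *: u.

(** Coefficients of [u] move to the left factor, so these tensors form a submodule containing all
    generators. *)
Lemma tensor_cyclic (N : lmodType R) (z : tensor N M) : exists n, z = tens n u.
Proof.
pose P (z : tensor N M) := exists n, z = tens n u.
have P_closed : P 0 /\ forall r x y, P x -> P y -> P (r *: x + y).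
  split; first by exists 0; rewrite tens0l.
  by move=> r _ _ [x ->] [y ->]; exists (r *: x + y); rewrite tensDl tensZl.
apply/(submod_ofP P_closed); apply: tensor_spanned => x y.
have [r ->] := u_gen y; apply/submod_ofP; exists (r *: x).
by rewrite tensZr tensZl.
Qed.

(* The bilinear map [(n, r *: u) |-> r *: n] is well defined modulo the elements
   fixed by some [E k], and an injective linear map reflects being fixed. *)
Lemma flat_cyclic (E : nat -> R) :
    (forall j k, (j <= k)%N -> E j * E k = E j) ->
    (forall r, r *: u = 0 <-> exists k, r = r * E k) ->
  flat M.
Proof.
move=> E_mono u_ann N N' f f_inj.
have E_le j k n : (j <= k)%N -> E j *: n = n -> E k *: n = n :> N'.
  by move=> jk <-; rewrite scalerA mulrC E_mono.
pose P (n : N') := exists k, E k *: n = n.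
have P_closed : P 0 /\ forall r x y, P x -> P y -> P (r *: x + y).
  split; first by exists 0; rewrite scaler0.
  move=> r x y [j jx] [k ky]; exists (maxn j k).
  rewrite scalerDr scalerA [_ * r]mulrC -scalerA.
  by rewrite (E_le j) ?leq_maxl// (E_le k) ?leq_maxr.
pose EN := submod_of P_closed.
have EN_ann r n : r *: u = 0 -> r *: n \in EN.
  move=> /u_ann[k rE]; apply/submod_ofP; exists k.
  by rewrite scalerA mulrC -rE.
(* The chosen coefficient [c x] is not linear in [x], but its ambiguity annihilates [u], and such
   scalars send [N'] into [EN]. *)
have [c cE] := choice u_gen.
pose B (n : N') (x : M) : quotmod EN := quotmod_pi EN (c x *: n).
have B_bilinear : bilinear_for *:%R *:%R B.
  split=> [x|n] r y z; rewrite /B.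
    by rewrite scalerDr scalerA [_ * r]mulrC -scalerA linearP.
  rewrite -linearP; apply/quotmod_piP.
  rewrite scalerA -scalerDl -scalerBl; apply: EN_ann.
  by rewrite scalerBl scalerDl -scalerA -!cE subrr.
apply: (@raddf_inj _ _ (tensor_map M f)) => z.
have [n ->] := tensor_cyclic z => fn0.
have {}fn0 : tens (f n) u = 0 by rewrite -tensor_mapE.
have Bfn0 : B (f n) u = 0.
  by rewrite -(tensor_liftE B_bilinear) fn0 tensor_lift0.
have /submod_ofP[k fnE] : f n \in EN.
  move: Bfn0; rewrite -(raddf0 (quotmod_pi EN)) => /quotmod_piP.
  rewrite subr0 => cfn.
  (* [c u] need not be 1; the missing multiple [1 - c u] annihilates [u]. *)
  have : (1 - c u) *: f n \in EN.
    by apply: EN_ann; rewrite scalerBl scale1r -cE subrr.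
  by move=> /(rpredD cfn); rewrite -scalerDl addrC subrK scale1r.
have {fnE}nE : E k *: n = n by apply: f_inj; rewrite linearZ.
rewrite -nE tensZl -tensZr.
have -> : E k *: u = 0 by apply/u_ann; exists k; rewrite E_mono.
exact: tens0r.
Qed.

End FlatCyclic.

(** * First flat modules, and bundling of linear maps *)

Lemma flat_zero (R : comNzRingType) : flat ('rV[R]_0 : lmodType R).
Proof.
(* The generator 0 is annihilated by all of [R], that is, by the ideal of the idempotent 1. *)
apply: (@flat_cyclic _ _ 0 _ (fun=> 1)) => [x|j k _|r]; last 2 first.
- by rewrite mulr1.
- by rewrite scaler0; split=> // _; exists 0; rewrite mulr1.
by exists 0; rewrite scaler0; apply: thinmx0.
Qed.

Lemma flat_regular (R : comNzRingType) : flat (R^o : lmodType R).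
Proof.
apply: (@flat_cyclic _ _ (1 : R^o) _ (fun=> 0)) => [x|j k _|r].
- by exists x; rewrite [RHS]mulr1.
- by rewrite mul0r.
- rewrite [r *: _]mulr1; split=> [->|[_ ->]]; last exact: mulr0.
  by exists 0; rewrite mul0r.
Qed.

Lemma linear_ex (R : comNzRingType) (L M : lmodType R) (h : L -> M) :
  linear h -> exists g : {linear L -> M}, forall x, g x = h x.
Proof.
move=> h_lin.
exists (HB.pack_for {linear L -> M} h (GRing.isLinear.Build R L M _ h h_lin)).
by [].
Qed.

Lemma submod_corestrict (R : comNzRingType) (L M : lmodType R)
    (N : submodClosed M) (f : {linear L -> M}) :
    (forall x, f x \in N) ->
  exists g : {linear L -> submod N}, forall x, val (g x) = f x.
Proof.
move=> fN.
have g_lin : linear (fun x => MkSubmod (fN x)).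
  by move=> r x y; apply/val_inj; rewrite /= !linearP.
by have [g gE] := linear_ex g_lin; exists g => x; rewrite gE.
Qed.

(** * Resolutions of length 0 and splicing *)

Section Resolutions.
Variables (R : comNzRingType) (Q : lmodType R -> Prop).

Lemma has_resolution0 (M : lmodType R) :
  Q 'rV[R]_0 -> Q M -> has_resolution Q M 0.
Proof.
move=> Q0 QM.
pose obj (i : nat) : lmodType R := if i is 0 then M else 'rV[R]_0.
pose diff i : {linear obj i.+1 -> obj i} := \0.
have obj0 i (x : obj i.+1) : x = 0 by apply: thinmx0.
have aug_surj : surjective (idfun : {linear obj 0 -> M}) by move=> x; exists x.
have exact0 : exact_at (diff 0) (idfun : {linear obj 0 -> M}).
  by move=> y /=; split=> [->|[x <-]//]; exists 0.
have exactS i : exact_at (diff i.+1) (diff i).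
  by move=> y; split=> // _; exists 0; rewrite (obj0 i y).
exists (Resolution aug_surj exact0 exactS); split; first by case.
by case=> // i _ x; exact: obj0.
Qed.

(** The resolution of the kernel [K] is spliced onto [P] by the differential [i \o res_aug F];
    injectivity of [i] gives exactness in degree 1. *)
Lemma has_resolutionS (K P M : lmodType R) (i : {linear K -> P})
    (p : {linear P -> M}) (n : nat) :
    surjective p -> injective i -> exact_at i p -> Q P ->
  has_resolution Q K n -> has_resolution Q M n.+1.
Proof.
move=> p_surj i_inj ip_exact QP [F [QF F0]].
pose obj (j : nat) : lmodType R := if j is j'.+1 then F j' else P.
pose diff j : {linear obj j.+1 -> obj j} :=
  match j return {linear obj j.+1 -> obj j} with
  | 0 => i \o res_aug F
  | j'.+1 => res_diff F j'
  end.
have exact0 : exact_at (diff 0) (p : {linear obj 0 -> M}).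
  move=> y; split=> [/ip_exact[z <-]|[x <-]].
    by have [x <-] := res_aug_surj F z; exists x.
  by apply/ip_exact; exists (res_aug F x).
have exactS j : exact_at (diff j.+1) (diff j).
  case: j => [|j]; last exact: res_exactS.
  move=> y; rewrite -(res_exact0 y) /=; split=> [iy0|->]; last exact: raddf0.
  by apply: i_inj; rewrite iy0 raddf0.
have p_surj' : surjective (p : {linear obj 0 -> M}) by [].
exists (Resolution p_surj' exact0 exactS); split; first by case.
by case=> // j jn x; exact: F0.
Qed.

End Resolutions.

(** * Projective modules, including ideals exhausted by idempotents *)

Section Projective.
Variable R : comNzRingType.

Lemma projective_regular : projective (R^o : lmodType R).
Proof.
move=> M N g f g_surj; have [y yE] := g_surj (f 1).
have h_lin : linear (fun r : R^o => r *: y).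
  by move=> r x z; rewrite scalerDl scalerA.
have [h hE] := linear_ex h_lin; exists h => r.
by rewrite hE linearZ /= yE -linearZ /= [_ *: _]mulr1.
Qed.

Lemma projective_zero : projective ('rV[R]_0 : lmodType R).
Proof.
by move=> M N g f _; exists \0 => x /=; rewrite (thinmx0 x) !raddf0.
Qed.

(** The differences [e i] are orthogonal idempotents with partial sums [E k], so [J] is the direct
    sum of the ideals they generate, and preimages of the [f (e i)] can be chosen independently. *)
Lemma projective_idempotents (J : submodClosed R^o) (E : nat -> R) :
    E 0 = 0 -> (forall j k, (j <= k)%N -> E j * E k = E j) ->
    (forall r : R, (r : R^o) \in J <-> exists k, r = r * E k) ->
  projective (submod J).
Proof.
move=> E0 E_mono JE M N g f g_surj.
pose e i : R := E i.+1 - E i.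
have eE i k : (i < k)%N -> e i * E k = e i.
  by move=> ik; rewrite mulrBl !E_mono // ltnW.
have Ee i k : (k <= i)%N -> E k * e i = 0.
  by move=> ki; rewrite mulrBr !E_mono ?subrr // leqW.
have ee i : e i * e i = e i.
  by rewrite {2}/e mulrBr eE // [X in _ - X]mulrC Ee // subr0.
have sum_e k : \sum_(i < k) e i = E k.
  elim: k => [|k IHk]; first by rewrite big_ord0 E0.
  by rewrite big_ord_recr /= IHk addrC subrK.
have eJ i : (e i : R^o) \in J by apply/JE; exists i.+1; rewrite eE.
have [y yE] := choice (fun i => g_surj (f (MkSubmod (eJ i)))).
have J_supp (x : submod J) : exists k, (val x : R) = val x * E k.
  by apply/JE; exact: valP.
have [s sE] := choice J_supp.
have s_le x k : (s x <= k)%N -> (val x : R) = val x * E k.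
  by move=> sk; rewrite [LHS]sE [in RHS]sE -mulrA E_mono.
pose H k (x : submod J) := \sum_(i < k) ((val x : R) * e i) *: y i.
(* The bound [s x] is not additive in [x]; since larger bounds give the same sum, linearity can be
   checked at a common one. *)
have HE x k : (s x <= k)%N -> H k x = H (s x) x.
  elim: k => [|k IHk]; first by rewrite leqn0 => /eqP ->.
  rewrite leq_eqVlt => /predU1P[->//|sk].
  have xe0 : (val x : R) * e k = 0 by rewrite (s_le x k) // -mulrA Ee ?mulr0.
  by rewrite -IHk // {1}/H big_ord_recr /= xe0 scale0r addr0.
have h_lin : linear (fun x => H (s x) x).
  move=> r x z; pose k := maxn (s (r *: x + z)) (maxn (s x) (s z)).
  rewrite -!(HE _ k) ?leq_max ?leqnn ?orbT // /H scaler_sumr -big_split /=.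
  by apply: eq_bigr => i _; rewrite mulrDl scalerDl scalerA mulrA.
have [h hE] := linear_ex h_lin; exists h => x; rewrite hE /H raddf_sum /=.
under eq_bigr => i _ do rewrite linearZ /= yE -linearZ /=.
rewrite -raddf_sum; congr (f _); apply: val_inj.
rewrite (raddf_sum (val : {linear submod J -> R^o})) /=.
rewrite [RHS]sE -sum_e mulr_sumr; apply: eq_bigr => i _.
(* The second factor [e i] is the argument of [f]; idempotence absorbs it. *)
by rewrite -[in RHS](ee i) mulrA.
Qed.

End Projective.

(** * The ideal [tR] and the quotient [C = R/tR] *)

Lemma cyclic_submoduleP (R : nzRingType) (M : lmodType R) (v x : M) :
  reflect (exists r : R, x = r *: v) (x \in cyclic_submodule v).
Proof. exact: asboolP. Qed.

Lemma mem_cyclic_submodule (R : nzRingType) (M : lmodType R) (v : M) :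
  v \in cyclic_submodule v.
Proof. by apply/cyclic_submoduleP; exists 1; rewrite scale1r. Qed.

Section CyclicQuotient.
Variables (R : comNzRingType) (t : R).

Local Notation tR := (cyclic_submodule (t : R^o)).
Local Notation C := (quotmod tR).
Local Notation pi := (quotmod_pi tR : {linear R^o -> C}).

Let pi_surj : surjective pi := @quotmod_pi_surj _ _ tR.

Lemma quotmod_pi_eq0 (r : R^o) : pi r = 0 <-> r \in tR.
Proof. by rewrite -(raddf0 pi) (quotmod_piP tR) subr0. Qed.

Lemma cyclic_quotient_scale1 : t *: pi 1 = 0.
Proof.
rewrite -linearZ; apply/quotmod_pi_eq0/cyclic_submoduleP; exists 1.
by rewrite scale1r [LHS]mulr1.
Qed.

(** Multiplication by [t] on [R], seen as rows of length 1, is the relation map. *)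
Lemma cyclic_quotient_finitely_presented : finitely_presented C.
Proof.
have f_lin : linear (fun x : 'rV[R]_1 => pi (x 0 0)).
  by move=> r x y; rewrite !mxE linearP.
have [f fE] := linear_ex f_lin.
have g_lin : linear (fun x : 'rV[R]_1 => t *: x).
  by move=> r x y; rewrite scalerDr !scalerA mulrC.
have [g gE] := linear_ex g_lin.
exists 1, 1, g, f; split=> [x|z]; last first.
  have [r <-] := pi_surj z; exists (const_mx r).
  by rewrite fE mxE.
rewrite fE quotmod_pi_eq0; split=> [/cyclic_submoduleP[r xE]|[y <-]].
  exists (const_mx r); rewrite gE; apply/rowP => j.
  by rewrite ord1 !mxE xE mulrC.
by apply/cyclic_submoduleP; exists (y 0 0); rewrite gE mxE mulrC.
Qed.

(** Length 0 would make [C] isomorphic to the flat module [F 0]. Tensoring the inclusion of [tR] in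
    [R] with it kills the class of [t] in [tR/t^2R], the tensor product of [tR] and [C]. *)
Lemma flat_resolution_cyclic_quotient_gt0 (n : nat) :
  (forall r, t <> r * t * t) -> has_resolution (@flat R) C n -> (0 < n)%N.
Proof.
move=> t_irreg [F [F_flat F0]]; rewrite lt0n; apply/eqP => n0.
have aug_inj : injective (res_aug F).
  apply: raddf_inj => x /res_exact0[y <-].
  by rewrite (F0 1 _ y) ?n0 // raddf0.
have [c cE] := choice pi_surj.
pose t2R := cyclic_submodule (t * t : R^o).
(* Representatives of a class of [C] differ by elements of [tR], so multiplying them with [y] in
   [tR] is well defined modulo [t2R]. *)
pose B (y : submod tR) (x : F 0) : quotmod t2R :=
  quotmod_pi t2R ((c (res_aug F x) : R) * (val y : R) : R).
have t2RM (r s : R^o) : r \in tR -> s \in tR -> (r : R) * s \in t2R.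
  move=> /cyclic_submoduleP[r' ->] /cyclic_submoduleP[s' ->].
  by apply/cyclic_submoduleP; exists (r' * s'); rewrite [LHS]mulrACA.
have B_bilinear : bilinear_for *:%R *:%R B.
  have scaleM (r y z x : R) : x * (r * y + z) = r * (x * y) + x * z.
    by rewrite mulrDr mulrCA.
  split=> [x|y] r u v; rewrite /B /= -linearP.
    by congr quotmod_pi; exact: scaleM.
  apply/quotmod_piP.
  suff : (c (res_aug F (r *: u + v)) - (r * c (res_aug F u) + c (res_aug F v)))
           * val y \in t2R by rewrite mulrBl mulrDl -mulrA.
  apply: t2RM; last exact: valP.
  by apply/(quotmod_piP tR); rewrite cE [RHS]linearP !cE linearP.
pose t' : submod tR := MkSubmod (mem_cyclic_submodule (t : R^o)).
have [x xE] := res_aug_surj F (pi 1).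
have tx0 : t *: x = 0.
  by apply: aug_inj; rewrite linearZ /= xE cyclic_quotient_scale1 raddf0.
have t'x0 : tens t' x = 0.
  apply: (F_flat 0 _ _ (val : {linear submod tR -> R^o})); first exact: val_inj.
  have -> : tensor_map (F 0) val (tens t' x) = tens (t *: 1 : R^o) x.
    by rewrite tensor_mapE; congr tens; exact/esym/mulr1.
  by rewrite tensZl -tensZr tx0 tens0r raddf0.
have := tensor_liftE B_bilinear t' x.
rewrite t'x0 tensor_lift0 // /B xE => /esym.
rewrite -(raddf0 (quotmod_pi t2R)) => /quotmod_piP; rewrite subr0 /= => ct.
(* [c (pi 1)] is 1 only modulo [tR]; the error times [t] lies in [t2R]. *)
have : t \in t2R.
  have -> : t = (1 - c (pi 1)) * t + c (pi 1) * t.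
    by rewrite -mulrDl subrK mul1r.
  apply: rpredD ct; apply: t2RM (mem_cyclic_submodule _).
  by apply/(quotmod_piP tR); rewrite cE.
by move=> /cyclic_submoduleP[r tE]; apply: (t_irreg r); rewrite -mulrA.
Qed.

(** * Upper bounds when idempotents exhaust the annihilator of [t] *)

Variable E : nat -> R.
Hypothesis E0 : E 0 = 0.
Hypothesis E_mono : forall j k, (j <= k)%N -> E j * E k = E j.
Hypothesis t_ann : forall r, r * t = 0 <-> exists k, r = r * E k.

(** This cover of [tR] by [R] has the annihilator of [t] as kernel, which is the second syzygy of
    [C]. *)
Lemma scale_cyclic_ex : exists g : {linear R^o -> submod tR},
  forall r : R, val (g r) = r * t :> R.
Proof.
have f_lin : linear (fun r : R^o => (r * t : R^o)).
  by move=> r x y; rewrite mulrDl; congr (_ + _); exact/esym/mulrA.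
have [f fE] := linear_ex f_lin.
have ftR r : f r \in tR by rewrite fE; apply/cyclic_submoduleP; exists r.
have [g gE] := submod_corestrict ftR; exists g => r.
by rewrite gE fE.
Qed.

Lemma flat_cyclic_submodule : flat (submod tR).
Proof.
pose t' : submod tR := MkSubmod (mem_cyclic_submodule (t : R^o)).
apply: (@flat_cyclic _ _ t' _ E) => // [x|r].
  have /cyclic_submoduleP[r xE] := valP x; exists r; exact: val_inj.
rewrite -t_ann; split=> [rt0|rt0]; last exact: val_inj.
exact: (congr1 val rt0).
Qed.

Lemma flat_resolution_cyclic_quotient : has_resolution (@flat R) C 1.
Proof.
apply: (@has_resolutionS _ _ (submod tR) R^o C val pi _ pi_surj val_inj).
- move=> r; rewrite quotmod_pi_eq0; split=> [rt|[x <-]]; last exact: valP.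
  by exists (MkSubmod rt).
- exact: flat_regular.
- exact: has_resolution0 (@flat_zero R) flat_cyclic_submodule.
Qed.

Lemma projective_resolution_cyclic_quotient :
  has_resolution (@projective R) C 2.
Proof.
have [g gE] := scale_cyclic_ex.
pose P (r : R^o) := (r : R) * t = 0.
have P_closed : P 0 /\ forall r x y, P x -> P y -> P (r *: x + y).
  split; first exact: mul0r.
  by move=> r x y Px Py; rewrite /P mulrDl Py -mulrA Px mulr0 addr0.
pose J := submod_of P_closed.
have JP (r : R^o) : r \in J <-> (r : R) * t = 0.
  by split=> [/submod_ofP//|rt0]; apply/submod_ofP.
apply: (@has_resolutionS _ _ (submod tR) R^o C val pi _ pi_surj val_inj).
- move=> r; rewrite quotmod_pi_eq0; split=> [rt|[x <-]]; last exact: valP.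
  by exists (MkSubmod rt).
- exact: projective_regular.
apply: (@has_resolutionS _ _ (submod J) R^o (submod tR) val g _ _ val_inj).
- move=> x; have /cyclic_submoduleP[r xE] := valP x.
  by exists r; apply: val_inj; rewrite gE.
- move=> r; have -> : g r = 0 <-> r \in J.
    rewrite JP -gE; split=> [->//|gr0]; exact: val_inj.
  split=> [rJ|[x <-]]; last exact: valP.
  by exists (MkSubmod rJ).
- exact: projective_regular.
apply: has_resolution0; first exact: projective_zero.
apply: (projective_idempotents E0 E_mono) => r.
by rewrite JP t_ann.
Qed.

(** * Obstructions when the idempotents never stabilize *)

Hypothesis E_strict : forall k, E k.+1 <> E k.

(** The test element is [E k.+1]: it annihilates [t], but its product with [E k] is [E k]. *)
Let E_dominates_none k : ~ forall r, r * t = 0 -> r = r * E k.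
Proof.
move=> domE; apply: (E_strict (k := k)).
rewrite [LHS]domE; first by rewrite mulrC E_mono.
by apply/t_ann; exists k.+1; rewrite E_mono.
Qed.

(* Comparing the resolution with [R -> C] yields [w] such that [w * t = t] and
   the annihilator of [t] kills [w], that is, a splitting of [R -> tR]. *)
Lemma projective_resolution_cyclic_quotient_gt1 (n : nat) :
  has_resolution (@projective R) C n -> (1 < n)%N.
Proof.
move=> [F [F_proj F0]]; rewrite ltnNge; apply/negP => n1.
have d_inj : injective (res_diff F 0).
  apply: raddf_inj => x /res_exactS[y <-].
  by rewrite (F0 2 _ y) ?raddf0.
have [g gE] := F_proj 0 _ _ pi (res_aug F) pi_surj.
have gdtR x : (g \o res_diff F 0) x \in tR.
  by apply/quotmod_pi_eq0; rewrite /= gE; apply/res_exact0; exists x.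
have [q qE] := submod_corestrict gdtR.
have [b bE] := scale_cyclic_ex.
have b_surj : surjective b.
  move=> x; have /cyclic_submoduleP[r xE] := valP x.
  by exists r; apply: val_inj; rewrite bE.
(* [g] and [l] form the comparison map in degrees 0 and 1. *)
have [l lE] := F_proj 1 _ _ b q b_surj.
have {}lE x : (l x : R) * t = g (res_diff F 0 x) by rewrite -bE lE qE.
have [p0 p0E] := res_aug_surj F (pi 1).
have [p pE] : exists p, res_diff F 0 p = t *: p0.
  by apply/res_exact0; rewrite linearZ /= p0E cyclic_quotient_scale1.
have p_ann r : r * t = 0 -> r * (l p : R) = 0.
  move=> rt0; rewrite -[r * _]/(r *: l p) -linearZ.
  have -> : r *: p = 0; last exact: raddf0.
  by apply: d_inj; rewrite linearZ /= pE scalerA rt0 scale0r raddf0.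
have /cyclic_submoduleP[u gp0] : g p0 - 1 \in tR.
  by apply/(quotmod_piP tR); rewrite gE.
(* [g p0] equals [1 + u * t]; subtracting [u * t] removes the resulting error in [l p * t]. *)
pose w := (l p : R) - u * t.
have lpt : (l p : R) * t = t * (u * t + 1).
  by rewrite lE pE linearZ /= -[g p0](subrK 1) gp0.
have wt : w * t = t by rewrite mulrBl lpt mulrDr mulr1 mulrC addrAC subrr add0r.
have w_ann r : r * t = 0 -> r * w = 0.
  by move=> rt0; rewrite mulrBr p_ann // mulrCA rt0 mulr0 subr0.
(* A single [E k] fixes [1 - w], hence every annihilator [r = r * (1 - w)]. *)
have /t_ann[k wE] : (1 - w) * t = 0 by rewrite mulrBl mul1r wt subrr.
apply: (@E_dominates_none k) => r /w_ann rw0.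
have r1 : r = r * (1 - w) by rewrite mulrBr rw0 mulr1 subr0.
by rewrite {1}r1 wE mulrA -r1.
Qed.

(* A lift [h] of [f] through [R -> tR] maps the relations [g y] to
   annihilators of [t], all of them dominated by a single [E k]. *)
Lemma cyclic_submodule_not_finitely_presented :
  ~ finitely_presented (submod tR).
Proof.
move=> [p [q [g [f [gf_exact f_surj]]]]].
have [b bE] := scale_cyclic_ex.
have c_ex j : exists r : R, r * t = val (f (delta_mx 0 j)) :> R.
  by have /cyclic_submoduleP[r ->] := valP (f (delta_mx 0 j)); exists r.
have [c cE] := choice c_ex.
pose h (x : 'rV[R]_q) := \sum_j x 0 j * c j.
have hZ r x : h (r *: x) = r * h x.
  by rewrite /h mulr_sumr; apply: eq_bigr => j _; rewrite mxE mulrA.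
have hD x y : h (x + y) = h x + h y.
  by rewrite /h -big_split; apply: eq_bigr => j _; rewrite mxE mulrDl.
have hE x : h x * t = val (f x) :> R.
  rewrite [x in RHS]row_sum_delta raddf_sum.
  rewrite (raddf_sum (val : {linear submod tR -> R^o})) /= mulr_suml.
  by apply: eq_bigr => j _; rewrite linearZ /= -mulrA cE.
have gk y : exists k, h (g y) = h (g y) * E k.
  by apply/t_ann; rewrite hE (_ : f (g y) = 0) //; apply/gf_exact; exists y.
have [s sE] := choice (fun i : 'I_p => gk (delta_mx 0 i)).
pose t' : submod tR := MkSubmod (mem_cyclic_submodule (t : R^o)).
have [v vE] := f_surj t'.
have /t_ann[k0 vk0] : (1 - h v) * t = 0.
  by rewrite mulrBl mul1r hE vE /= subrr.
(* One bound serves [1 - h v] and the finitely many generating relations. *)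
pose k := maxn k0 (\max_i s i).
have le_fix r j : (j <= k)%N -> r = r * E j -> r = r * E k.
  by move=> jk rE; rewrite [LHS]rE [in RHS]rE -mulrA E_mono.
have hg y : h (g y) = h (g y) * E k.
  have [H HE] : exists H : {linear 'rV[R]_q -> R^o}, forall x, H x = h x.
    by apply: linear_ex => r x z; rewrite hD hZ.
  rewrite [y]row_sum_delta -HE !raddf_sum /= mulr_suml; apply: eq_bigr => i _.
  rewrite !linearZ /= HE -[_ *: _]/(_ * _) -mulrA; congr (_ * _).
  by apply: (le_fix _ (s i)) => //; rewrite leq_max leq_bigmax orbT.
apply: (@E_dominates_none k) => r rt0.
have /gf_exact[y yE] : f (r *: v) = 0.
  by apply: val_inj; rewrite linearZ /= vE.
(* As [r *: v] is the relation [g y], both summands are fixed by [E k]. *)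
have rE : r = r * (1 - h v) + h (g y) by rewrite yE hZ -mulrDr subrK mulr1.
by rewrite {1}rE {1}(le_fix _ k0 _ vk0) ?leq_maxl // hg mulrA -mulrDl -rE.
Qed.

End CyclicQuotient.

(** * The idempotents of the ring [Tring m] and the annihilator of [(a, 0)] *)

Section TruncationIdempotents.
Variables (A : comNzRingType) (m : idealr A).

Local Notation kappa := {ideal_quot m}.

Lemma truncation_eventually_residue (k : nat) :
  ((0, fun i => (i < k)%N%:R) : A * (nat -> kappa)) \in @eventually_residue A m.
Proof.
apply/asboolP; apply: (@sub_finite_set _ _ `I_k) => // i /=.
move=> ne0; rewrite ltnNge; apply/negP => ki; apply: ne0.
by rewrite ltnNge ki; apply/esym/rmorph0.
Qed.

(** These are the idempotents [e_k]. *)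
Definition truncation (k : nat) : Tring m :=
  MkTring (truncation_eventually_residue k).

Lemma Tring_eqP (x y : Tring m) :
  (Tring_val x).1 = (Tring_val y).1 ->
  (forall i, (Tring_val x).2 i = (Tring_val y).2 i) -> x = y.
Proof.
move=> xy1 xy2; apply: val_inj => /=.
move: (Tring_val x) (Tring_val y) xy1 xy2 => [x1 x2] [y1 y2] /= -> xy2.
by congr pair; apply/funext.
Qed.

Lemma truncation0 : truncation 0 = 0.
Proof. exact: Tring_eqP. Qed.

Lemma truncation_mono (j k : nat) :
  (j <= k)%N -> truncation j * truncation k = truncation j.
Proof.
move=> jk; apply: Tring_eqP => [|i]; first exact: mul0r.
rewrite [LHS]/((i < j)%N%:R * (i < k)%N%:R) /=.
case: ltnP => [ij|_]; last exact: mul0r.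
by rewrite (leq_trans ij jk); exact: mulr1.
Qed.

Lemma truncation_strict (k : nat) : truncation k.+1 <> truncation k.
Proof.
move=> /(congr1 (fun x => (Tring_val x).2 k)) /= /eqP.
by rewrite ltnSn ltnn oner_eq0.
Qed.

(** Regularity of [a] forces first coordinate 0 on an annihilator, so its sequence has finite
    support and is unchanged by a long enough truncation. *)
Lemma Tring0_ann (a : A) (am : a \in m) (x : Tring m) :
  GRing.lreg a -> x * Tring0 am = 0 <-> exists k, x = x * truncation k.
Proof.
move=> a_reg; split=> [xa0|[k ->]]; last first.
  have -> : x * truncation k * Tring0 am = x * (truncation k * Tring0 am).
    by rewrite mulrA.
  have -> : truncation k * Tring0 am = 0; last by rewrite mulr0.
  apply: Tring_eqP => [|i]; first exact: (mul0r a).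
  exact: (mulr0 ((i < k)%N%:R : kappa)).
have x10 : (Tring_val x).1 = 0.
  have xa10 : (Tring_val x).1 * a = 0 := congr1 (fun y => (Tring_val y).1) xa0.
  by apply: a_reg; rewrite mulr0 mulrC.
have /asboolP /finite_seqP[s sE] : Tring_val x \in @eventually_residue A m.
  by case: (x).
(* [truncation k] keeps the indices below [k], hence the successor. *)
exists (\max_(i <- s) i).+1; apply: Tring_eqP => [|i].
  by rewrite x10; exact/esym/(mulr0 (Tring_val x).1).
rewrite [RHS]/((Tring_val x).2 i * (i < (\max_(i <- s) i).+1)%N%:R).
have [//|si] := ltnP; first by rewrite [RHS]mulr1.
rewrite [RHS](mulr0 ((Tring_val x).2 i)); apply: contrapT => xi.
have is_ : i \in s.
  have : [set` s]%classic i.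
    by rewrite -sE /= x10 => xi0; apply: xi; rewrite xi0 rmorph0.
  by [].
by have := @leq_bigmax_seq _ s xpredT id i is_ isT; rewrite leqNgt si.
Qed.

End TruncationIdempotents.

Theorem proposition6p3 (A : comUnitRingType) (m : idealr A)
    (A_local : is_local m) (a : A)
    (a_regular : GRing.lreg a) (a_nonunit : a \isn't a GRing.unit) :
  let R : comNzRingType := Tring m in
  let t : R := Tring0 (nonunit_maximal A_local a_nonunit) in
  let tR : submodClosed R^o := cyclic_submodule (t : R^o) in
  let C : lmodType R := quotmod tR in
  [/\ fd_eq C 1, pd_eq C 2, finitely_presented C
    & ~ finitely_presented (submod tR)].
Proof.
move=> R t tR C.
have t_ann (r : R) :=
  Tring0_ann (nonunit_maximal A_local a_nonunit) r a_regular.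
have E0 := truncation0 m.
have E_mono := @truncation_mono A m.
have E_strict := @truncation_strict A m.
(* In first coordinates, cancelling the regular [a] would give it an inverse. *)
have t_irreg (r : R) : t <> r * t * t.
  move=> tE; have aE : a = (Tring_val r).1 * a * a.
    exact: (congr1 (fun x => (Tring_val x).1) tE).
  apply: (negP a_nonunit); apply/unitrPr; exists (Tring_val r).1.
  by apply: a_regular; rewrite mulr1 [RHS]aE mulrA -[RHS]mulrA [RHS]mulrC.
split.
- split; first exact: flat_resolution_cyclic_quotient E_mono t_ann.
  by move=> k; exact: flat_resolution_cyclic_quotient_gt0.
- split; first exact: projective_resolution_cyclic_quotient E0 E_mono t_ann.
  exact: projective_resolution_cyclic_quotient_gt1 E_mono t_ann E_strict.
- exact: cyclic_quotient_finitely_presented.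
- exact: cyclic_submodule_not_finitely_presented E_mono t_ann E_strict.
Qed.
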